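(* Let $(R,\mathfrak m)$ be a complete noetherian local integral domain of dimension one with fraction field $Q$, and let $S$ be an indecomposable torsion-free $R$-module of finite rank. Then $Q/R\otimes_R S$ is indecomposable, provided it is nonzero.
   Context: The rank of a torsion-free $R$-module $S$ is $\dim_Q(Q\otimes_R S)$. A nonzero module is indecomposable if it is not the direct sum of two nonzero submodules. *)

(* Defs.v *)
From HB Require Import structures.
From mathcomp Require Import all_boot all_algebra.
From mathcomp Require Import boolp.
From mathcomp Require Import freeg.

Set Implicit Arguments.
Unset Strict Implicit.
Unset Printing Implicit Defensive.

Import GRing.Theory.
Local Open Scope ring_scope.
Local Open Scope quotient_scope.

(* Subsets are boolean predicates, as in MathComp. By boolp every predicate is
   equivalent to a boolean one, so submodClosed M ranges over all submodules
   of M, idealr R over all proper ideals of the commutative ring R, and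
   prime_idealr R over all its prime ideals. *)

Section Submodules.
Variables (R : nzRingType) (V : lmodType R).

Definition gen_submod (E : V -> Prop) : {pred V} := fun v =>
  `[< forall W : submodClosed V, (forall e, E e -> e \in W) -> v \in W >].

Lemma gen_submod_closed E : submod_closed (gen_submod E).
Proof.
split=> [|a u v]; first by apply/asboolP => W _; apply: rpred0.
move=> /asboolP Eu /asboolP Ev; apply/asboolP => W EW.
by apply: rpredD; [apply: rpredZ; apply: Eu | apply: Ev].
Qed.

HB.instance Definition _ E :=
  GRing.isSubmodClosed.Build R V (gen_submod E) (gen_submod_closed E).

Lemma mem_gen_submod (E : V -> Prop) e : E e -> e \in gen_submod E.
Proof. by move=> Ee; apply/asboolP => W EW; apply: EW. Qed.

End Submodules.

(* submodClosed does not record closure under opposite, which Quotient.quot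
   requires; over a ring it follows from closure under scaling. *)
Definition submod_zmod (R : nzRingType) (V : lmodType R) (N : submodClosed V) :
  {pred V} := N.

HB.instance Definition _ (R : nzRingType) (V : lmodType R) (N : submodClosed V) :=
  GRing.isZmodClosed.Build V (submod_zmod N) (GRing.submod_closedB (submodClosedP N)).

Definition modquot (R : nzRingType) (V : lmodType R) (N : submodClosed V) :=
  Quotient.quot (submod_zmod N).

Section QuotientModule.
Variables (R : nzRingType) (V : lmodType R) (N : submodClosed V).
Local Notation VN := (modquot N).

HB.instance Definition _ := GRing.Zmodule.on VN.

Definition modproj (v : V) : VN := \pi_(Quotient.quot (submod_zmod N)) v.
Definition modrepr (x : VN) : V := repr (x : Quotient.quot (submod_zmod N)).

Lemma modreprK : cancel modrepr modproj.
Proof. exact: reprK. Qed.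

Lemma modproj_eqP (u v : V) : reflect (modproj u = modproj v) (u - v \in N).
Proof. by rewrite -[_ \in N]/(_ \in submod_zmod N) Quotient.idealrBE; apply: eqP. Qed.

Fact modprojB : zmod_morphism modproj.
Proof. by move=> u v; rewrite /modproj raddfB. Qed.

HB.instance Definition _ := GRing.isZmodMorphism.Build V VN modproj modprojB.

Definition modquot_scale (a : R) (x : VN) : VN := modproj (a *: modrepr x).

Lemma modquot_scale_proj a v : modquot_scale a (modproj v) = modproj (a *: v).
Proof.
apply/modproj_eqP; rewrite -scalerBr; apply: rpredZ.
by apply/modproj_eqP; rewrite modreprK.
Qed.

Fact modquot_scaleA a b x :
  modquot_scale a (modquot_scale b x) = modquot_scale (a * b) x.
Proof. by rewrite -[x]modreprK !modquot_scale_proj scalerA. Qed.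

Fact modquot_scale1 : left_id 1 modquot_scale.
Proof. by move=> x; rewrite -[x]modreprK modquot_scale_proj scale1r. Qed.

Fact modquot_scaleDr : right_distributive modquot_scale +%R.
Proof.
move=> a x y; rewrite -[x]modreprK -[y]modreprK.
by rewrite -raddfD !modquot_scale_proj scalerDr raddfD.
Qed.

Fact modquot_scaleDl x : {morph modquot_scale^~ x : a b / a + b}.
Proof.
by move=> a b; rewrite -[x]modreprK !modquot_scale_proj scalerDl raddfD.
Qed.

HB.instance Definition _ := GRing.Zmodule_isLmodule.Build R VN
  modquot_scaleA modquot_scale1 modquot_scaleDr modquot_scaleDl.

Fact modproj_scalable : scalable modproj.
Proof. by move=> a v; rewrite -modquot_scale_proj. Qed.

HB.instance Definition _ :=
  GRing.isScalable.Build R V VN *:%R modproj modproj_scalable.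

End QuotientModule.

Section FreeModule.
Variables (R : comNzRingType) (K : choiceType) (M : lmodType R) (f : K -> M).

Lemma freegUZ a c x : a *: << c *g x >> = << a * c *g x >> :> {freeg K / R}.
Proof. by apply/eqP/freeg_eqP => y; rewrite coeffZ !coeffU mulrA. Qed.

Fact fglift_linear : linear (fglift f : {freeg K / R} -> M).
Proof.
pose g : {additive {freeg K / R} -> M} := HB.pack (fglift f)
  (GRing.isZmodMorphism.Build _ _ _ (@lift_is_additive R K M f)).
move=> a D E; rewrite -[fglift f]/(g : _ -> _) raddfD; congr (_ + _).
rewrite -[D]freeg_sumE scaler_sumr !raddf_sum.
by apply: eq_bigr => x _; rewrite freegUZ /= !liftU scalerA.
Qed.

HB.instance Definition _ :=
  GRing.isLinear.Build R {freeg K / R} M *:%R (fglift f) fglift_linear.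

End FreeModule.

Section Tensor.
Variables (R : comNzRingType) (M N : lmodType R).
Local Notation F := {freeg (M * N)%type / R}.
Local Notation "<[ x , y ]>" := (<< (x, y) >> : F).

Inductive tensor_rel : F -> Prop :=
| TensorDl x x' y : tensor_rel (<[x + x', y]> - (<[x, y]> + <[x', y]>))
| TensorDr x y y' : tensor_rel (<[x, y + y']> - (<[x, y]> + <[x, y']>))
| TensorZl a x y : tensor_rel (<[a *: x, y]> - a *: <[x, y]>)
| TensorZr a x y : tensor_rel (<[x, a *: y]> - a *: <[x, y]>).

Definition tensor := modquot (gen_submod tensor_rel).
HB.instance Definition _ := GRing.Lmodule.on tensor.

Definition tens (x : M) (y : N) : tensor := modproj _ <[x, y]>.

Lemma tensDl x x' y : tens (x + x') y = tens x y + tens x' y.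
Proof. by rewrite -raddfD; apply/modproj_eqP/mem_gen_submod; constructor. Qed.

Lemma tensDr x y y' : tens x (y + y') = tens x y + tens x y'.
Proof. by rewrite -raddfD; apply/modproj_eqP/mem_gen_submod; constructor. Qed.

Lemma tensZl a x y : tens (a *: x) y = a *: tens x y.
Proof. by rewrite -linearZ; apply/modproj_eqP/mem_gen_submod; constructor. Qed.

Lemma tensZr a x y : tens x (a *: y) = a *: tens x y.
Proof. by rewrite -linearZ; apply/modproj_eqP/mem_gen_submod; constructor. Qed.

Lemma tensor_ind (P : tensor -> Prop) :
  P 0 -> (forall a x y t, P t -> P (a *: tens x y + t)) -> forall t, P t.
Proof.
move=> P0 PD t; rewrite -[t]modreprK -[modrepr t]freeg_sumE.
elim: (dom _) => [|[x y] s IHs]; first by rewrite big_nil raddf0.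
rewrite big_cons raddfD /=.
by rewrite -[coeff _ _]mulr1 -freegUZ linearZ; apply: PD.
Qed.

Section Lift.
Variables (P : lmodType R) (b : M -> N -> P).

Definition tensor_lift (t : tensor) : P :=
  fglift (fun p => b p.1 p.2) (modrepr t).

Hypotheses (bl : forall y, linear (b^~ y)) (br : forall x, linear (b x)).

Let bL y : {linear M -> P} := HB.pack (b^~ y) (GRing.isLinear.Build R M P _ _ (bl y)).
Let bR x : {linear N -> P} := HB.pack (b x) (GRing.isLinear.Build R N P _ _ (br x)).

Let phi : {linear F -> P} := fglift (fun p => b p.1 p.2).

Let phiU x y : phi <[x, y]> = b x y.
Proof. by rewrite /phi /= liftU scale1r. Qed.

Let ker_closed : submod_closed (fun v : F => `[< phi v = 0 >]).
Proof.
split=> [|a u v]; first by apply/asboolP; rewrite linear0.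
by move=> /asboolP u0 /asboolP v0; apply/asboolP; rewrite linearP u0 v0 scaler0 addr0.
Qed.

Let phi_rel v : v \in gen_submod tensor_rel -> phi v = 0.
Proof.
pose K : submodClosed F := HB.pack (fun v : F => `[< phi v = 0 >])
  (GRing.isSubmodClosed.Build R F _ ker_closed).
move=> /asboolP /(_ K) vK; apply/asboolP; apply: vK => _ [x x' y|x y y'|a x y|a x y];
  apply/asboolP; apply/eqP; rewrite linearB subr_eq0.
- by rewrite linearD !phiU [b _ _](linearD (bL y)).
- by rewrite linearD !phiU [b _ _](linearD (bR x)).
- by rewrite linearZ /= !phiU [b _ _](linearZ_LR (bL y)).
- by rewrite linearZ /= !phiU [b _ _](linearZ_LR (bR x)).
Qed.

Lemma tensor_lift_proj v : tensor_lift (modproj _ v) = phi v.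
Proof.
apply/eqP; rewrite -subr_eq0 -[tensor_lift _]/(phi _) -linearB; apply/eqP.
by apply: phi_rel; apply/modproj_eqP; rewrite modreprK.
Qed.

Lemma tensor_liftE x y : tensor_lift (tens x y) = b x y.
Proof. by rewrite tensor_lift_proj phiU. Qed.

Lemma tensor_lift_linear : linear tensor_lift.
Proof.
move=> a t u; rewrite -[t]modreprK -[u]modreprK -linearP.
by rewrite !tensor_lift_proj linearP.
Qed.

End Lift.

End Tensor.

Section FractionModule.
Variable R : idomainType.
Local Notation Q := {fraction R}.

Definition frac_scale (a : R) (q : Q) : Q := FracField.tofrac a * q.

Fact frac_scaleA a b q : frac_scale a (frac_scale b q) = frac_scale (a * b) q.
Proof. by rewrite /frac_scale mulrA rmorphM. Qed.

Fact frac_scale1 : left_id 1 frac_scale.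
Proof. by move=> q; rewrite /frac_scale rmorph1 mul1r. Qed.

Fact frac_scaleDr : right_distributive frac_scale +%R.
Proof. by move=> a p q; rewrite /frac_scale mulrDr. Qed.

Fact frac_scaleDl q : {morph frac_scale^~ q : a b / a + b}.
Proof. by move=> a b; rewrite /frac_scale rmorphD mulrDl. Qed.

HB.instance Definition _ := GRing.Zmodule_isLmodule.Build R Q
  frac_scaleA frac_scale1 frac_scaleDr frac_scaleDl.

(* The image of R in Q. *)
Definition frac_base : {pred Q} := fun q => `[< exists r, q = FracField.tofrac r >].

Fact frac_base_closed : submod_closed (frac_base : {pred (Q : lmodType R)}).
Proof.
split=> [|a _ _ /asboolP[r ->] /asboolP[s ->]]; apply/asboolP.
  by exists 0; rewrite rmorph0.
by exists (a * r + s); rewrite rmorphD rmorphM.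
Qed.

HB.instance Definition _ := GRing.isSubmodClosed.Build R Q frac_base frac_base_closed.

Definition frac_quot := modquot frac_base.
HB.instance Definition _ := GRing.Lmodule.on frac_quot.

End FractionModule.

Section ScalarExtension.
Variables (R : idomainType) (S : lmodType R).
Local Notation Q := {fraction R}.

(* An alias of tensor Q S, which is an R-module, carrying instead the structure
   of a Q-vector space in which Q acts on the left factor. *)
Definition frac_ext := tensor Q S.
HB.instance Definition _ := GRing.Zmodule.on frac_ext.

Let mulb (q : Q) (p : Q) (s : S) : tensor Q S := tens (q * p) s.

Let mulb_linearl q s : linear (mulb q ^~ s).
Proof.
move=> a p p'; rewrite -tensZl -tensDl; congr tens.
by rewrite mulrDr /GRing.scale /= /frac_scale mulrCA.
Qed.

Let mulb_linearr q p : linear (mulb q p).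
Proof. by move=> a s s'; rewrite /mulb tensDr tensZr. Qed.

Definition frac_ext_scale (q : Q) (t : frac_ext) : frac_ext :=
  tensor_lift (fun (p : Q) (s : S) => tens (q * p) s) t.

Lemma frac_ext_scale_tens q p s : frac_ext_scale q (tens p s) = tens (q * p) s.
Proof. exact: (tensor_liftE (mulb_linearl q) (mulb_linearr q)). Qed.

Let scaleP q : linear (frac_ext_scale q : tensor Q S -> tensor Q S).
Proof. exact: (tensor_lift_linear (mulb_linearl q) (mulb_linearr q)). Qed.

Let scaleL q : {linear tensor Q S -> tensor Q S} :=
  HB.pack (frac_ext_scale q : tensor Q S -> tensor Q S)
    (GRing.isLinear.Build R (tensor Q S) (tensor Q S) _ _ (scaleP q)).

Let scaleLE q (t : tensor Q S) : frac_ext_scale q t = scaleL q t.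
Proof. by []. Qed.

Fact frac_ext_scaleA p q t :
  frac_ext_scale p (frac_ext_scale q t) = frac_ext_scale (p * q) t.
Proof.
rewrite !scaleLE; elim/tensor_ind: t => [|a x s t IHt].
  by rewrite !linear0.
by rewrite !linearP IHt /= !frac_ext_scale_tens mulrA.
Qed.

Fact frac_ext_scale1 : left_id 1 frac_ext_scale.
Proof.
move=> t; rewrite scaleLE; elim/tensor_ind: t => [|a x s t IHt].
  by rewrite linear0.
by rewrite linearP IHt /= frac_ext_scale_tens mul1r.
Qed.

Fact frac_ext_scaleDr : right_distributive frac_ext_scale +%R.
Proof. by move=> q t u; rewrite !scaleLE linearD. Qed.

Fact frac_ext_scaleDl t : {morph frac_ext_scale^~ t : p q / p + q}.
Proof.
move=> p q; rewrite !scaleLE; elim/tensor_ind: t => [|a x s t IHt].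
  by rewrite !linear0 addr0.
by rewrite !linearP IHt /= !frac_ext_scale_tens mulrDl tensDl scalerDr addrACA.
Qed.

HB.instance Definition _ := GRing.Zmodule_isLmodule.Build Q frac_ext
  frac_ext_scaleA frac_ext_scale1 frac_ext_scaleDr frac_ext_scaleDl.

End ScalarExtension.

Section RingNotions.
Variable R : comNzRingType.

Definition fin_gen_ideal (I : {pred R}) : Prop :=
  exists n (g : 'I_n -> R),
    forall x, x \in I <-> exists c : 'I_n -> R, x = \sum_i c i * g i.

(* The ideals of R, including R itself, are the submodules of R^o. *)
Definition noetherian : Prop := forall I : submodClosed R^o, fin_gen_ideal I.

Definition maximal_ideal (m : idealr R) : Prop :=
  forall J : idealr R, {subset m <= J} -> J =i m.

Definition local_ring (m : idealr R) : Prop :=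
  maximal_ideal m /\ forall J : idealr R, maximal_ideal J -> J =i m.

Fixpoint ideal_pow (I : {pred R}) (n : nat) (x : R) : Prop :=
  if n is n'.+1 then
    exists k (a b : 'I_k -> R),
      [/\ forall i, a i \in I, forall i, ideal_pow I n' (b i)
        & x = \sum_i a i * b i]
  else True.

(* A sequence with x (n+1) = x n modulo I^n is an element of the inverse limit
   of the rings R / I^n; the canonical map from R to this limit is bijective. *)
Definition adic_complete (I : {pred R}) : Prop :=
  forall x : nat -> R, (forall n, ideal_pow I n (x n.+1 - x n)) ->
    exists! y, forall n, ideal_pow I n (y - x n).

Definition prime_chain n (p : 'I_n.+1 -> prime_idealr R) : Prop :=
  forall i j : 'I_n.+1, (i < j)%N ->
    {subset p i <= p j} /\ exists2 x, x \in p j & x \notin p i.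

Definition krull_dim_eq (d : nat) : Prop :=
  (exists p : 'I_d.+1 -> prime_idealr R, prime_chain p) /\
  forall n (p : 'I_n.+1 -> prime_idealr R), prime_chain p -> (n <= d)%N.

End RingNotions.

Definition indecomposable (R : nzRingType) (M : lmodType R) : Prop :=
  (exists x : M, x != 0) /\
  forall A B : submodClosed M,
    (forall x : M, exists a b, [/\ a \in A, b \in B & x = a + b]) ->
    (forall x : M, x \in A -> x \in B -> x = 0) ->
    (forall a, a \in A -> a = 0) \/ (forall b, b \in B -> b = 0).

Section RankNotions.
Variables (R : idomainType) (S : lmodType R).

Definition torsion_free : Prop :=
  forall (a : R) (x : S), a *: x = 0 -> a = 0 \/ x = 0.

Definition has_rank (n : nat) : Prop :=
  inhabited (Vector.axiom n (frac_ext S : lmodType {fraction R})).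

Definition finite_rank : Prop := exists n, has_rank n.

End RankNotions.

(* Main.v *)
(* Let t be a nonzero element of m. Every nonunit has a power in tR, so Q = R[1/t],
   the m-adic and t-adic topologies of R agree, and the quotients of R^n by t^j R^n
   satisfy the descending chain condition. Every element of D = Q/R (x) S has the
   form [1/t^n] (x) s, and it vanishes iff s is in t^n S.

   The intersection W of the t^n S is divisible, hence a direct summand of S. If
   W = S, then D = 0. Otherwise W = 0; for a free submodule F = R^k of maximal rank
   in S, Chevalley's theorem on linear topologies gives t^n S within F for some n, so
   that S is t-adically complete.

   If now D = A + B is direct, let S_A consist of the s with [1/t^n] (x) s in A for
   all n, and define S_B likewise. Splitting [1/t^n] (x) s along A and B for each n
   yields a Cauchy sequence in S, and its limit is the S_A-component of s. So S is
   the direct sum of S_A and S_B, and D inherits indecomposability from S. *)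

Require Import Defs.
From HB Require Import structures.
From mathcomp Require Import all_boot all_algebra.
From mathcomp Require Import boolp.
From mathcomp Require classical_sets.
From mathcomp Require Import freeg.

Set Implicit Arguments.
Unset Strict Implicit.
Unset Printing Implicit Defensive.

Import GRing.Theory.
Local Open Scope ring_scope.

(** * Submodules *)

Section SubmoduleConstructions.
Variables (R : nzRingType) (V : lmodType R).

Definition mk_submod (P : V -> Prop)
    (PC : submod_closed (fun v => `[< P v >])) : submodClosed V :=
  HB.pack (fun v => `[< P v >]) (GRing.isSubmodClosed.Build R V _ PC).

Lemma in_mk_submod (P : V -> Prop) PC v : v \in @mk_submod P PC <-> P v.
Proof. by split=> /asboolP. Qed.

Lemma submod_closedI (P : V -> Prop) :
  P 0 -> (forall a u v, P u -> P v -> P (a *: u + v)) ->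
  submod_closed (fun v => `[< P v >]).
Proof.
by move=> P0 PD; split=> [|a u v /asboolP Pu /asboolP Pv]; apply/asboolP; auto.
Qed.

Lemma submod_of (P : V -> Prop) :
  P 0 -> (forall a u v, P u -> P v -> P (a *: u + v)) ->
  exists N : submodClosed V, forall v, v \in N <-> P v.
Proof. by move=> P0 PD; exists (mk_submod (submod_closedI P0 PD)) => v; exact: in_mk_submod. Qed.

Lemma submod_rpredB (N : submodClosed V) u v : u \in N -> v \in N -> u - v \in N.
Proof. by move=> uN vN; rewrite -scaleN1r rpredD ?rpredZ. Qed.

Fact add_line_closed (B : submodClosed V) (g : V) :
  submod_closed (fun v => `[< exists r, v - r *: g \in B >]).
Proof.
apply: submod_closedI => [|a u v [r ru] [s sv]].
  by exists 0; rewrite scale0r subr0 rpred0.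
exists (a * r + s); rewrite scalerDl -scalerA opprD addrACA -scalerBr.
by rewrite rpredD ?rpredZ.
Qed.

Definition add_line B g := mk_submod (add_line_closed B g).

Lemma add_lineP (B : submodClosed V) g v : v \in add_line B g <-> exists r, v - r *: g \in B.
Proof. exact: in_mk_submod. Qed.

Lemma sub_add_line (B : submodClosed V) g : {subset B <= add_line B g}.
Proof. by move=> v vB; apply/add_lineP; exists 0; rewrite scale0r subr0. Qed.

Lemma mem_add_line (B : submodClosed V) g : g \in add_line B g.
Proof. by apply/add_lineP; exists 1; rewrite scale1r subrr rpred0. Qed.

(** Zorn's lemma for submodules; it supplies maximal ideals, primes avoiding the powers of an
    element, and complements of divisible submodules. *)
Lemma exists_maximal_avoiding (U : submodClosed V) (X : V -> Prop) :
  (forall v, v \in U -> ~ X v) ->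
  exists W : submodClosed V,
    [/\ {subset U <= W}, forall v, v \in W -> ~ X v
      & forall g, g \notin W -> exists2 v, v \in add_line W g & X v].
Proof.
move=> UX.
pose P (A : V -> Prop) := (A = fun=> False) \/ exists W : submodClosed V,
  [/\ A = (fun v => v \in W), {subset U <= W} & forall v, v \in W -> ~ X v].
have [F FP Ftot|A [PA Amax]] := @classical_sets.Zorn_bigcup V P.
  have [[W [A FA AW]]|noW] := pselect (exists W : submodClosed V,
      exists2 A, F A & A = fun v => v \in W); last first.
    left; apply/funext => v; apply/propext; split=> // -[A FA Av].
    case: (FP _ FA) => [A0|[W [AW _ _]]]; first by rewrite A0 in Av.
    by apply: noW; exists W, A.
  have nonempty B v : F B -> B v -> exists2 W' : submodClosed V,
      B = (fun v => v \in W') & {subset U <= W'} /\ forall v, v \in W' -> ~ X v.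
    move=> FB Bv; case: (FP _ FB) => [B0|[W' [BW' UW' W'X]]].
      by rewrite B0 in Bv.
    by exists W'.
  have A0 : A 0 by rewrite AW; apply: rpred0.
  have [|a u v [B FB Bu] [C FC Cv]|N NE] :=
    @submod_of (fun v => exists2 B, F B & B v).
  - by exists A.
  - have [BC|CB] := Ftot _ _ FB FC.
      exists C => //; have [W' CW' _] := nonempty _ _ FC Cv.
      move: Cv (BC _ Bu); rewrite CW' => Cv Cu.
      by apply: rpredD => //; apply: rpredZ.
    exists B => //; have [W' BW' _] := nonempty _ _ FB Bu.
    move: Bu (CB _ Cv); rewrite BW' => Bu Bv.
    by apply: rpredD => //; apply: rpredZ.
  right; exists N; split.
  - by apply/funext => v; apply/propext; rewrite NE.
  - have [W' AW' [UW' _]] := nonempty _ _ FA A0.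
    by move=> v vU; apply/NE; exists A => //; rewrite AW'; apply: UW'.
  - move=> v /NE[B FB Bv]; have [W' BW' [_ W'X]] := nonempty _ _ FB Bv.
    by apply: W'X; rewrite BW' in Bv.
have PW (W : submodClosed V) : {subset U <= W} -> (forall v, v \in W -> ~ X v) ->
  P (fun v => v \in W) by right; exists W.
case: PA => [A0|[W [AW UW WX]]].
  suff /Amax : classical_sets.proper A (fun v => v \in U) by case; apply: PW.
  by rewrite A0; split=> [v []|sub0]; apply: (sub0 0 (rpred0 U)).
exists W; split=> // g gW; apply: contrapT => noX.
case: (Amax (fun v => v \in add_line W g)); last first.
  apply: PW => [v vU|v vW Xv]; first by apply/sub_add_line/UW.
  by apply: noX; exists v.
rewrite AW; split=> [|/(_ g)]; first exact: sub_add_line.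
by move/(_ (mem_add_line _ _)); apply/negP.
Qed.

End SubmoduleConstructions.

(** * One-dimensional complete local domains *)

Section LocalDomain.
Variables (R : idomainType) (m : idealr R).

Lemma submod_idealr_closed (I : submodClosed R^o) :
  1 \notin I -> idealr_closed (fun x : R => x \in I).
Proof.
move=> I1; split=> [|//|a u v uI vI]; first exact: rpred0.
by apply: rpredD => //; apply: (rpredZ (a : R)).
Qed.

Lemma ideal_of_submod (I : submodClosed R^o) : 1 \notin I ->
  exists J : idealr R, forall x, (x \in J) = (x \in I).
Proof.
move/submod_idealr_closed => IC.
by exists (HB.pack_for (idealr R) (fun x : R => x \in I) (isIdealr.Build R _ IC)).
Qed.

Lemma principal_submod (t : R) :
  exists I : submodClosed R^o, forall x : R, x \in I <-> exists c, x = c * t.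
Proof.
apply: submod_of => [|a _ _ [c ->] [d ->]]; first by exists 0; rewrite mul0r.
by exists (a * c + d); rewrite mulrDl -mulrA.
Qed.

Lemma exists_maximal_ideal (I : submodClosed R^o) : 1 \notin I ->
  exists2 J : idealr R, maximal_ideal J & {subset I <= J}.
Proof.
move=> I1; have [|W [IW W1 Wmax]] := @exists_maximal_avoiding _ _ I (fun x => x = 1).
  by move=> v vI v1; rewrite -v1 vI in I1.
have [|J JE] := @ideal_of_submod W; first by apply/negP => /W1.
exists J => [K JK|x /IW]; last by rewrite JE.
move=> x; apply/idP/idP => [xK|]; last exact: JK.
rewrite JE; apply: contraT => /Wmax[y /add_lineP[r yr] y1].
have /negP[] := negbT (idealr1 K).
rewrite -(subrK (r * x) 1) rpredD ?idealMr //.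
by apply: JK; rewrite JE -y1.
Qed.

Hypothesis m_local : local_ring m.

(** A nonunit generates a proper ideal, which lies in a maximal ideal, and [m] is the only one. *)
Lemma notin_maximal_unit x : x \notin m -> x \is a GRing.unit.
Proof.
move=> xm; have [I IE] := principal_submod x.
have [/IE[c c1]|I1] := boolP (1 \in I).
  by apply/unitrP; exists c; rewrite [x * c]mulrC -c1.
have [J /(proj2 m_local) Jm IJ] := exists_maximal_ideal I1.
by case/negP: xm; rewrite -Jm; apply/IJ/IE; exists 1; rewrite mul1r.
Qed.

Lemma unit_notin_ideal (J : idealr R) x : x \is a GRing.unit -> x \notin J.
Proof.
move=> xU; apply/negP => xJ; have /negP[] := negbT (idealr1 J).
by rewrite -(mulVr xU) idealMr.
Qed.

Lemma ideal_sub_maximal (J : idealr R) : {subset J <= m}.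
Proof.
by move=> x; apply: contraLR => /notin_maximal_unit; apply: unit_notin_ideal.
Qed.

Lemma prime_ideal_of (P : R -> Prop) : P 0 ->
  (forall a u v, P u -> P v -> P (a * u + v)) -> ~ P 1 ->
  (forall u v, P (u * v) -> P u \/ P v) ->
  exists J : prime_idealr R, forall x, x \in J <-> P x.
Proof.
move=> P0 PD P1 PM; have [||I IE] := @submod_of R R^o P; [by []|by []|].
have IC : idealr_closed (fun x : R => x \in I).
  by apply: submod_idealr_closed; apply/negP => /IE.
have IP : prime_idealr_closed (fun x : R => x \in I).
  by move=> u v /IE /PM[] /IE uI; apply/orP; [left|right].
by exists (HB.pack_for (prime_idealr R) (fun x : R => x \in I)
  (isIdealr.Build R _ IC) (isPrimeIdealrClosed.Build R _ IP)).
Qed.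

Hypothesis dim1 : krull_dim_eq R 1.

Lemma exists_nonzero_nonunit : exists2 t, t \in m & t != 0.
Proof.
have [[p pC] _] := dim1.
have [//|_ [t tp1 tp0]] := pC ord0 ord_max.
exists t; first exact: ideal_sub_maximal tp1.
by apply: contraNneq tp0 => ->; apply: rpred0.
Qed.

(* Otherwise an ideal maximal among those that contain t and no power of x
   is a prime strictly between 0 and m. *)
Lemma dvd_power t x : t != 0 -> x \in m -> exists n c, x ^+ n = c * t.
Proof.
move=> t0 xm; apply: contrapT => no.
have [I IE] := principal_submod t.
have [|W [IW WX Wmax]] := @exists_maximal_avoiding _ _ I (fun y => exists n, y = x ^+ n).
  by move=> v /IE[c ->] [n E]; apply: no; exists n, c.
have Wideal a u : u \in W -> a * u \in W by move=> uW; apply: (rpredZ (a : R)).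
have [||||P PE] := @prime_ideal_of (fun y => y \in W).
- exact: rpred0.
- by move=> a u v uW vW; apply: rpredD => //; apply: Wideal.
- by move/WX; apply; exists 0%N; rewrite expr0.
- move=> u v uvW; have [|uW] := boolP (u \in W); [by left|].
  have [|vW] := boolP (v \in W); [by right|].
  have [y /add_lineP[r Wr] [i E]] := Wmax _ uW; rewrite {y}E in Wr.
  have [y /add_lineP[s Ws] [j E]] := Wmax _ vW; rewrite {y}E in Ws.
  case: (WX (x ^+ (i + j))); last by exists (i + j)%N.
  (* Modulo [W], x^i = r u and x^j = s v, so x^(i+j) = r s u v, which lies in [W]. *)
  have -> : x ^+ (i + j) = x ^+ j * (x ^+ i - r * u) +
      ((r * u) * (x ^+ j - s * v) + (r * s) * (u * v)).
    rewrite exprD !mulrBr mulrACA [x ^+ j * x ^+ i]mulrC.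
    by rewrite subrK [x ^+ j * _]mulrC addrNK.
  by apply: rpredD; last apply: rpredD; apply: Wideal.
have [||||Z ZE] := @prime_ideal_of (fun y => y = 0).
- by [].
- by move=> a u v -> ->; rewrite mulr0 addr0.
- by apply/eqP; rewrite oner_eq0.
- by move=> u v /eqP; rewrite mulf_eq0 => /orP[] /eqP; [left|right].
have [||||M ME] := @prime_ideal_of (fun y => y \in m).
- exact: rpred0.
- by move=> a u v um vm; rewrite rpredD // idealMr.
- by rewrite idealr1.
- move=> u v uvm; have [|um] := boolP (u \in m); [by left|].
  have [|vm] := boolP (v \in m); [by right|].
  move: uvm; rewrite (negPf (unit_notin_ideal _ _)) // unitrM.
  by rewrite !notin_maximal_unit.
have tP : t \in P by apply/PE/IW/IE; exists 1; rewrite mul1r.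
have xP : x \notin P by apply/negP => /PE /WX; apply; exists 1%N; rewrite expr1.
(* The chain is 0, [P], [m]; the default value of [nth] supplies its last term. *)
have [_ /(_ 2 (fun i : 'I_3 => nth M [:: Z; P] i)) bound] := dim1.
suff /bound : prime_chain (fun i : 'I_3 => nth M [:: Z; P] i) by [].
case=> -[|[|[|]]] //= ? [] [|[|[|]]] //= ? _.
- split=> [y /ZE ->|]; first exact: rpred0.
  by exists t => //; apply/negP => /ZE /eqP; apply/negP.
- split=> [y /ZE ->|]; first exact: rpred0.
  by exists x; [apply/ME|apply: contra xP => /ZE ->; exact: rpred0].
- split=> [y yP|]; last by exists x => //; apply/ME.
  by apply/ME; apply: ideal_sub_maximal yP.
Qed.

(** * Powers of the maximal ideal inside principal ideals *)

Hypothesis R_noetherian : noetherian R.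

Lemma maximal_fin_gen : exists r (a : 'I_r -> R),
  (forall i, a i \in m) /\ forall x, x \in m -> exists c : 'I_r -> R, x = \sum_i c i * a i.
Proof.
have [||I IE] := @submod_of R R^o (fun x => x \in m).
- exact: rpred0.
- by move=> b u v um vm; rewrite rpredD // idealMr.
have [r [a aI]] := R_noetherian I; exists r, a; split=> [i|x /IE /aI //].
apply/IE/aI; exists (fun j => (i == j)%:R).
rewrite (bigD1 i) //= eqxx mul1r big1 ?addr0 // => j /negPf ji.
by rewrite eq_sym ji mul0r.
Qed.

Section Generators.
Variables (r : nat) (a : 'I_r -> R).
Hypothesis am : forall i, a i \in m.
Hypothesis a_gen : forall x, x \in m -> exists c : 'I_r -> R, x = \sum_i c i * a i.

Lemma size_sum_count (w : seq 'I_r) : size w = (\sum_i count_mem i w)%N.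
Proof.
elim: w => [|x w IHw] /=; first by rewrite big1.
rewrite big_split /= -IHw (bigD1 x) //= eqxx big1 // => i /negPf ix.
by rewrite eq_sym ix.
Qed.

Lemma dvd_word i (w : seq 'I_r) :
  exists c, \prod_(j <- w) a j = c * a i ^+ count_mem i w.
Proof.
elim: w => [|x w [c IHw]] /=; first by exists 1; rewrite big_nil mulr1.
rewrite big_cons IHw; case: eqP => [->|_].
  by exists c; rewrite exprS mulrCA.
by exists (a x * c); rewrite add0n mulrA.
Qed.

(** Pigeonhole: if t divides a_i^(M i) for each i, a word longer than the sum of the M i contains
    some letter i at least M i times. *)
Lemma words_dvd t : t != 0 -> exists N, forall w : seq 'I_r, size w = N ->
  exists c, \prod_(i <- w) a i = c * t.
Proof.
move=> t0; have /choice[M HM] := fun i => dvd_power t0 (am i).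
exists (\sum_i M i).+1 => w sw.
have [i Mi] : exists i, (M i <= count_mem i w)%N.
  apply: contrapT => no; suff : (size w <= \sum_i M i)%N by rewrite sw ltnn.
  rewrite size_sum_count; apply: leq_sum => i _; rewrite leqNgt.
  by apply/negP => /ltnW Mi; apply: no; exists i.
have [c ->] := dvd_word i w; have [d ad] := HM i.
exists (c * a i ^+ (count_mem i w - M i) * d).
by rewrite -{1}(subnK Mi) exprD ad !mulrA.
Qed.

(** The words of length N generate m^N. The factor [c] collects the generators already split off
    during the induction. *)
Lemma ideal_pow_word (I : submodClosed R^o) N (c y : R) :
  (forall w : seq 'I_r, size w = N -> c * \prod_(i <- w) a i \in I) ->
  ideal_pow m N y -> c * y \in I.
Proof.
elim: N c y => [|N IHN] c y Iw /=.
  move=> _; rewrite mulrC; apply: (rpredZ (y : R)).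
  by have := Iw [::] erefl; rewrite big_nil mulr1.
move=> [k [u [v [um vN ->]]]]; rewrite mulr_sumr; apply: rpred_sum => j _.
have [d ->] := a_gen (um j); rewrite mulr_suml mulr_sumr.
apply: rpred_sum => l _.
rewrite [c * _](_ : _ = d l * ((c * a l) * v j)); last by rewrite !mulrA [c * d l]mulrC.
apply: (rpredZ (d l : R)); apply: IHN (vN j) => w sw.
by rewrite -mulrA -(big_cons _ _ _ _ xpredT); apply: Iw => /=; rewrite sw.
Qed.

End Generators.

Lemma ideal_pow_dvd t : t != 0 ->
  exists N, forall y, ideal_pow m N y -> exists c, y = c * t.
Proof.
move=> t0; have [r [a [am a_gen]]] := maximal_fin_gen.
have [N HN] := words_dvd am t0; have [I IE] := principal_submod t.
exists N => y yN; apply/IE; rewrite -[y]mul1r.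
apply: (ideal_pow_word a_gen) yN => w /HN[c ->].
by rewrite mul1r; apply/IE; exists c.
Qed.

Lemma ideal_powD n k y : ideal_pow m (n + k) y -> ideal_pow m n y.
Proof.
elim: n y => [//|n IHn] y /= [l [u [v [um vn ->]]]].
by exists l, u, v; split=> // i; apply: IHn.
Qed.

Lemma ideal_pow_expr t n c : t \in m -> ideal_pow m n (c * t ^+ n).
Proof.
move=> tm; elim: n => [//|n IHn] /=.
exists 1%N, (fun=> t), (fun=> c * t ^+ n); split=> //.
by rewrite big_ord1 exprS mulrCA.
Qed.

(** * Completeness for the t-adic topology *)

Hypothesis R_complete : adic_complete m.

Lemma scale_telescope (V : lmodType R) t (x : nat -> V) :
  (forall n, exists u, x n.+1 - x n = t ^+ n *: u) ->
  forall n k, exists u, x (n + k)%N - x n = t ^+ n *: u.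
Proof.
move=> xC n; elim=> [|k [u IHk]]; first by exists 0; rewrite addn0 subrr scaler0.
have [v xk] := xC (n + k)%N; exists (t ^+ k *: v + u).
by rewrite -(subrKA (x (n + k)%N)) addnS xk IHk exprD scalerDr scalerA.
Qed.

(** The m-adic limit serves: modulo t^n it agrees with x (n + N), where m^N is contained in t^n R,
    and telescoping leads back to x n. *)
Lemma expr_adic_complete t (x : nat -> R) : t \in m -> t != 0 ->
  (forall n, exists c, x n.+1 - x n = t ^+ n * c) ->
  exists y, forall n, exists c, y - x n = t ^+ n * c.
Proof.
move=> tm t0 xC; have [n|y [yx _]] := R_complete (x := x).
  by have [c ->] := xC n; rewrite mulrC; apply: ideal_pow_expr.
exists y => n; have [N HN] := ideal_pow_dvd (expf_neq0 n t0).
have [c yN] : exists c, y - x (n + N)%N = c * t ^+ n.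
  by apply/HN/(@ideal_powD _ n); rewrite addnC; apply: yx.
have [d xN] := @scale_telescope R^o t x xC n N.
by exists (c + d); rewrite -(subrKA (x (n + N)%N)) yN xN mulrDr [c * _]mulrC.
Qed.

Lemma row_adic_complete k t (x : nat -> 'rV[R]_k) : t \in m -> t != 0 ->
  (forall n, exists u, x n.+1 - x n = t ^+ n *: u) ->
  exists y, forall n, exists u, y - x n = t ^+ n *: u.
Proof.
move=> tm t0 xC.
have /choice[y Hy] : forall i, exists y, forall n, exists c, y - x n 0 i = t ^+ n * c.
  move=> i; apply: expr_adic_complete => // n; have [u xu] := xC n.
  by exists (u 0 i); move/matrixP/(_ 0 i): xu; rewrite !mxE.
exists (\row_i y i) => n; have /choice[c Hc] := fun i => Hy i n.
by exists (\row_i c i); apply/rowP => i; rewrite !mxE Hc.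
Qed.

(** * The descending chain condition modulo a submodule *)

Section Stationary.
Variable V : lmodType R.
Implicit Types B : submodClosed V.

(* V/B satisfies the descending chain condition. *)
Definition stationary_mod B := forall U : nat -> submodClosed V,
  (forall k, {subset U k.+1 <= U k}) ->
  exists K, forall k v, v \in U K -> exists2 u, u \in U k & v - u \in B.

Lemma stationary_sub B B' : {subset B <= B'} -> stationary_mod B -> stationary_mod B'.
Proof.
move=> BB' BS U Udec; have [K HK] := BS U Udec.
by exists K => k v /(HK k)[u uU /BB' uv]; exists u.
Qed.

Lemma decreasing_subset (U : nat -> submodClosed V) :
  (forall k, {subset U k.+1 <= U k}) -> forall i j, (i <= j)%N -> {subset U j <= U i}.
Proof.
move=> Udec i j /subnK <-; elim: (j - i)%N => [//|k IHk] v.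
by rewrite addSn => /Udec /IHk.
Qed.

(** The module (B + Rg)/B is zero or simple. Either some [U k] meets B + Rg only inside B, and
    congruences modulo B + Rg become congruences modulo B; or every [U k] contains a unit multiple
    of g modulo B, which absorbs the error along g. *)
Lemma stationary_add_line B g : (forall b, b \in m -> b *: g \in B) ->
  stationary_mod (add_line B g) -> stationary_mod B.
Proof.
move=> mg BS U Udec; have [K HK] := BS U Udec.
have [[k0 Hk0]|no] := pselect (exists k0, forall v, v \in U k0 ->
    v \in add_line B g -> v \in B).
  exists (maxn K k0) => k v vU.
  have [u uU vuB] : exists2 u, u \in U (maxn k k0) & v - u \in add_line B g.
    by apply: HK; apply: decreasing_subset vU; rewrite ?leq_maxl.
  exists u; first by apply: decreasing_subset uU; rewrite ?leq_maxl.
  apply: Hk0 => //; apply: submod_rpredB.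
    by apply: decreasing_subset vU; rewrite ?leq_maxr.
  by apply: decreasing_subset uU; rewrite ?leq_maxr.
exists K => k v /(HK k)[u uU /add_lineP[c vuB]].
have [w wU [wB /add_lineP[d wdB]]] : exists2 w, w \in U k & w \notin B /\ w \in add_line B g.
  apply: contrapT => no'; apply: no; exists k => w wU wB.
  by apply: contraT => wnB; case: no'; exists w.
have dm : d \notin m.
  by apply: contra wB => /mg dgB; rewrite -(subrK (d *: g) w) rpredD.
have dU := notin_maximal_unit dm.
exists (u + (c / d) *: w); first by rewrite rpredD ?rpredZ.
have -> : v - (u + (c / d) *: w) = v - u - c *: g - (c / d) *: (w - d *: g).
  by rewrite scalerBr scalerA divrK // opprB addrA addrNK opprD addrA.
by rewrite submod_rpredB ?rpredZ.
Qed.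

Section Words.
Variables (r : nat) (a : 'I_r -> R).
Hypothesis a_gen : forall x, x \in m -> exists c : 'I_r -> R, x = \sum_i c i * a i.

Lemma add_lineS B B' g : {subset B <= B'} -> {subset add_line B g <= add_line B' g}.
Proof. by move=> BB' v /add_lineP[c /BB' vB]; apply/add_lineP; exists c. Qed.

(** The elements a_i g are killed modulo B by words one letter shorter, so induction allows
    adjoining them to B. The enlarged submodule contains m g, and adjoining g is then a simple
    step. *)
Lemma stationary_words N g B :
  (forall w : seq 'I_r, size w = N -> (\prod_(i <- w) a i) *: g \in B) ->
  stationary_mod (add_line B g) -> stationary_mod B.
Proof.
elim: N g B => [|N IHN] g B wB.
  apply: stationary_sub => v /add_lineP[c vB].
  rewrite -(subrK (c *: g) v) rpredD ?rpredZ //.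
  by have := wB [::] erefl; rewrite big_nil scale1r.
(* This is B + m g once [s] lists every index. *)
pose Bs := foldr (fun i (B' : submodClosed V) => add_line B' (a i *: g)) B.
have sub_Bs s : {subset B <= Bs s}.
  by elim: s => [//|i s IHs] v /IHs; apply: sub_add_line.
have mem_Bs s i : i \in s -> a i *: g \in Bs s.
  elim: s => [//|j s IHs]; rewrite inE => /predU1P[->|/IHs]; first exact: mem_add_line.
  exact: sub_add_line.
have from_Bs s : stationary_mod (Bs s) -> stationary_mod B.
  elim: s => [//|i s IHs] /= iS; apply/IHs/IHN/iS => w sw; apply: sub_Bs.
  by rewrite scalerA mulrC -(big_cons _ _ _ _ xpredT); apply: wB => /=; rewrite sw.
move=> gS; apply: (from_Bs (enum 'I_r)); apply: (@stationary_add_line _ g); last first.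
  by apply: stationary_sub gS; apply: add_lineS.
move=> b /a_gen[c ->]; rewrite scaler_suml; apply: rpred_sum => i _.
by rewrite -scalerA; apply/rpredZ/mem_Bs; rewrite mem_enum.
Qed.

End Words.

Definition in_multiples (t : R) (v : V) := exists u, v = t *: u.

Fact multiples_closed t : submod_closed (fun v => `[< in_multiples t v >]).
Proof.
apply: submod_closedI => [|b _ _ [u ->] [v ->]]; first by exists 0; rewrite scaler0.
by exists (b *: u + v); rewrite scalerDr !scalerA mulrC.
Qed.

Definition multiples t := mk_submod (multiples_closed t).

Lemma multiplesP t v : v \in multiples t <-> exists u, v = t *: u.
Proof. exact: in_mk_submod. Qed.

End Stationary.

(** Long words in the generators of m are divisible by t, hence kill each standard basis vector
    modulo t R^k. Adjoining all of these vectors yields R^k, for which the condition is trivial. *)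
Lemma row_stationary k t : t != 0 -> stationary_mod (multiples 'rV[R]_k t).
Proof.
move=> t0; have [r [a [am a_gen]]] := maximal_fin_gen.
have [N HN] := words_dvd am t0.
pose tV := multiples 'rV[R]_k t.
pose Bs := foldr (fun i (B : submodClosed 'rV[R]_k) => add_line B (delta_mx 0 i)) tV.
have sub_Bs s : {subset tV <= Bs s}.
  by elim: s => [//|i s IHs] v /IHs; apply: sub_add_line.
have mem_Bs s i : i \in s -> delta_mx 0 i \in Bs s.
  elim: s => [//|j s IHs]; rewrite inE => /predU1P[->|/IHs]; first exact: mem_add_line.
  exact: sub_add_line.
suff from_Bs s : stationary_mod (Bs s) -> stationary_mod tV.
  apply: (from_Bs (enum 'I_k)) => U _; exists 0%N => j v _.
  exists 0; first exact: rpred0.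
  rewrite subr0 (row_sum_delta v); apply: rpred_sum => i _.
  by apply/rpredZ/mem_Bs; rewrite mem_enum.
elim: s => [//|i s IHs] /= iS; apply/IHs/(stationary_words a_gen _ iS) => w /HN[c ->].
apply: sub_Bs; apply/multiplesP.
by exists (c *: delta_mx 0 i); rewrite scalerA mulrC.
Qed.

End LocalDomain.

(** * Tensor products with fractions *)

Lemma modproj_eq0 (R : nzRingType) (V : lmodType R) (N : submodClosed V) (v : V) :
  modproj N v = 0 <-> v \in N.
Proof.
rewrite -(linear0 (modproj N)); split=> [/modproj_eqP|vN].
  by rewrite subr0.
by apply/modproj_eqP; rewrite subr0.
Qed.

Lemma tensr0 (R : comNzRingType) (M N : lmodType R) (x : M) : tens x (0 : N) = 0.
Proof. by rewrite -(scale0r (0 : N)) tensZr scale0r. Qed.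

Lemma tensNr (R : comNzRingType) (M N : lmodType R) (x : M) (y : N) :
  tens x (- y) = - tens x y.
Proof. by rewrite -(scaleN1r y) tensZr scaleN1r. Qed.

Lemma tensNl (R : comNzRingType) (M N : lmodType R) (x : M) (y : N) :
  tens (- x) y = - tens x y.
Proof. by rewrite -(scaleN1r x) tensZl scaleN1r. Qed.

Section FractionTensor.
Variables (R : idomainType) (S : lmodType R).
Local Notation Q := {fraction R}.
Local Notation "x %:F" := (FracField.tofrac x).

Lemma tofrac_inj : injective (@FracField.tofrac R).
Proof. by move=> x y /eqP; rewrite tofrac_eq => /eqP. Qed.

Lemma fraction_scaleE (a : R) (q : Q) : a *: q = a%:F * q.
Proof. by []. Qed.

Lemma fraction_denom (q : Q) : exists2 d : R, d != 0 & exists n : R, d%:F * q = n%:F.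
Proof.
elim/quotW: q => x; exists (frac x).2; first exact: denom_ratioP.
exists (frac x).1; unlock FracField.tofrac.
rewrite -[LHS]FracField.pi_mul; apply/eqmodP.
rewrite /= FracField.equivfE /FracField.mulf /=.
by rewrite !numden_Ratio ?mulf_neq0 ?oner_eq0 ?denom_ratioP // mulr1 !mul1r mulrC.
Qed.

Lemma fraction_denomM (e e' : R) (q : Q) (n : R) : e%:F * q = n%:F -> (e' * e)%:F * q = (e' * n)%:F.
Proof. by move=> E; rewrite !rmorphM -mulrA E. Qed.

(* The numerator of q over the denominator e, and 0 if e is not a denominator of q. *)
Definition fraction_num (e : R) (q : Q) : R :=
  if pselect (exists n : R, e%:F * q = n%:F) is left h then projT1 (cid h) else 0.

Lemma fraction_numE (e : R) (q : Q) (n : R) : e%:F * q = n%:F -> fraction_num e q = n.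
Proof.
rewrite /fraction_num; case: pselect => [h|no] E; last by case: no; exists n.
by case: (cid h) => n' /= E'; apply: tofrac_inj; rewrite -E -E'.
Qed.

Let clear_denom (e : R) : {linear {freeg (Q * S)%type / R} -> S} :=
  fglift (fun p => fraction_num e p.1 *: p.2).

Let clear_denomU (e : R) (q : Q) s (n : R) : e%:F * q = n%:F -> clear_denom e << (q, s) >> = n *: s.
Proof. by move=> E; rewrite /clear_denom /= liftU scale1r (fraction_numE E). Qed.

(* Each relation of the tensor product involves at most two fractions, and
   clearing a common denominator of these turns it into an identity in S. *)
Let clear_denom_rel v : v \in gen_submod (tensor_rel (M := Q) (N := S)) ->
  exists2 d : R, d != 0 & forall e, clear_denom (e * d) v = 0.
Proof.
(* Quantifying over all multiples of d lets two denominators be merged into their product. *)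
have [||K KE] := @submod_of R {freeg (Q * S)%type / R} (fun v =>
  exists2 d : R, d != 0 & forall e, clear_denom (e * d) v = 0).
- by exists 1; rewrite ?oner_eq0 // => e; rewrite linear0.
- move=> a u w [d d0 du] [d' d'0 dw]; exists (d * d'); first exact: mulf_neq0.
  by move=> e; rewrite linearP {1}[d * d']mulrC !mulrA du dw scaler0 addr0.
move=> /asboolP /(_ K) vK; apply/KE/vK => _ [x x' y|x y y'|a x y|a x y]; apply/KE.
- have [d d0 [n dx]] := fraction_denom x; have [d' d'0 [n' dx']] := fraction_denom x'.
  exists (d * d') => [|e]; first exact: mulf_neq0.
  rewrite !linearB /= !linearD /=.
  have xE := fraction_denomM (e * d') dx; have x'E := fraction_denomM (e * d) dx'.
  have dE : e * d' * d = e * (d * d') by rewrite -mulrA [d' * d]mulrC.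
  rewrite -mulrA in x'E; rewrite dE in xE.
  rewrite (clear_denomU _ xE) (clear_denomU _ x'E).
  rewrite (@clear_denomU _ _ _ (e * d' * n + e * d * n')) ?scalerDl -?opprD ?subrr //.
  by rewrite mulrDr xE x'E rmorphD.
- have [d d0 [n dx]] := fraction_denom x; exists d => // e.
  have xE := fraction_denomM e dx.
  by rewrite !linearB !linearD /= !(clear_denomU _ xE) scalerDr -opprD subrr.
- have [d d0 [n dx]] := fraction_denom x; exists d => // e.
  have xE := fraction_denomM e dx.
  rewrite !linearB !linearZ /= !(clear_denomU _ xE) (@clear_denomU _ _ _ (a * (e * n))).
    by rewrite scalerN scalerA subrr.
  by rewrite fraction_scaleE mulrCA xE -rmorphM.
- have [d d0 [n dx]] := fraction_denom x; exists d => // e.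
  have xE := fraction_denomM e dx.
  by rewrite !linearB !linearZ /= !(clear_denomU _ xE) scalerN !scalerA mulrC subrr.
Qed.

Hypothesis S_tf : torsion_free S.

Lemma scaler_inj a (s s' : S) : a != 0 -> a *: s = a *: s' -> s = s'.
Proof.
move=> /eqP a0 E; have /S_tf[//|/eqP] : a *: (s - s') = 0.
  by rewrite scalerBr E subrr.
by rewrite subr_eq0 => /eqP.
Qed.

(** Clearing denominators in a combination of tensor relations equal to (1, s) leaves d s = 0 with d
    nonzero. *)
Lemma tens1_eq0 (s : S) : tens (1 : Q) s = 0 -> s = 0.
Proof.
move=> s0; have /clear_denom_rel[d d0 /(_ 1)] :
    << (1, s) >> \in gen_submod (tensor_rel (M := Q) (N := S)).
  by apply/modproj_eq0.
rewrite mul1r (@clear_denomU _ _ _ (d)).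
  by case/S_tf => // d00; rewrite d00 eqxx in d0.
by rewrite mulr1.
Qed.

Lemma tens_tofrac (a : R) (s : S) : tens (a%:F : Q) s = tens (1 : Q) (a *: s).
Proof. by rewrite tensZr -tensZl fraction_scaleE mulr1. Qed.

(** * Elements of Q/R (x) S *)

Definition fraction_inv (e : R) : frac_quot R := modproj (@frac_base R) (e%:F)^-1.

Lemma fraction_invM c e : c != 0 -> e != 0 -> c *: fraction_inv (c * e) = fraction_inv e.
Proof.
move=> c0 e0; rewrite -linearZ; congr (modproj _ _).
rewrite fraction_scaleE rmorphM invfM mulrA divff ?mul1r //.
by rewrite tofrac_eq0.
Qed.

Lemma fraction_inv1 : fraction_inv 1 = 0.
Proof.
apply/modproj_eq0; rewrite rmorph1 invr1.
by apply/asboolP; exists 1; rewrite rmorph1.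
Qed.

Lemma scaler_fraction_inv e : e != 0 -> e *: fraction_inv e = 0.
Proof. by move=> e0; rewrite -fraction_inv1 -(fraction_invM e0 (oner_neq0 _)) mulr1. Qed.

Fact tens1_closed : submod_closed (fun t : tensor Q S => `[< exists s, t = tens (1 : Q) s >]).
Proof.
apply: submod_closedI => [|a _ _ [s ->] [s' ->]].
  by exists 0; rewrite tensr0.
by exists (a *: s + s'); rewrite tensDr tensZr.
Qed.

Let S1 := mk_submod tens1_closed.

(** The pairing behind the map from Q/R (x) S to (Q (x) S)/S. The choice of representative is
    harmless because r (x) s = 1 (x) r s lies in [S1]. *)
Let quot_pair (q : frac_quot R) (s : S) : modquot S1 :=
  modproj S1 (tens (modrepr q : Q) s).

Let quot_pairE (q : Q) s : quot_pair (modproj _ q) s = modproj S1 (tens q s).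
Proof.
apply/modproj_eqP; have /modproj_eqP/asboolP[r rE] := modreprK (modproj (@frac_base R) q).
apply/in_mk_submod; exists (r *: s); rewrite -tens_tofrac -rE.
by rewrite tensDl tensNl.
Qed.

Let quot_pair_linl s : linear (quot_pair^~ s).
Proof.
move=> a p q; rewrite -[p]modreprK -[q]modreprK -linearP !quot_pairE.
by rewrite tensDl tensZl linearP.
Qed.

Let quot_pair_linr q : linear (quot_pair q).
Proof. by move=> a s s'; rewrite /quot_pair tensDr tensZr linearP. Qed.

(** The image in (Q (x) S)/S vanishes, so 1/e (x) s = 1 (x) s' for some s'. Multiplying by e gives 1
    (x) (s - e s') = 0, and S embeds in Q (x) S. *)
Lemma tens_fraction_inv_eq0 e (s : S) : e != 0 -> tens (fraction_inv e) s = 0 ->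
  exists s', s = e *: s'.
Proof.
move=> e0 /(congr1 (tensor_lift quot_pair)).
rewrite (tensor_liftE quot_pair_linl quot_pair_linr) quot_pairE.
pose L : {linear tensor (frac_quot R) S -> modquot S1} := HB.pack (tensor_lift quot_pair)
  (GRing.isLinear.Build _ _ _ _ _ (tensor_lift_linear quot_pair_linl quot_pair_linr)).
rewrite [RHS](linear0 L) => /modproj_eq0 /in_mk_submod[s' E]; exists s'; apply/eqP; rewrite -subr_eq0.
apply/eqP/tens1_eq0; rewrite tensDr tensNr tensZr -E -tensZl.
by rewrite fraction_scaleE divff ?subrr // tofrac_eq0.
Qed.

Lemma frac_quot_tensorP (d : tensor (frac_quot R) S) :
  exists2 e : R, e != 0 & exists s, d = tens (fraction_inv e) s.
Proof.
elim/tensor_ind: d => [|a q s _ [e e0 [s' ->]]].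
  by exists 1; [exact: oner_neq0|exists 0; rewrite tensr0].
rewrite -[q]modreprK; have [d d0 [n dq]] := fraction_denom (modrepr q).
exists (d * e); first exact: mulf_neq0.
(* With q the class of n/d, both summands are expanded to the denominator d e. *)
exists (a *: (e *: (n *: s)) + d *: s'); rewrite tensDr; congr (_ + _).
  rewrite tensZr; congr (_ *: _); rewrite tensZr -tensZl mulrC fraction_invM //.
  rewrite tensZr -tensZl; congr tens; rewrite -linearZ; congr (modproj _ _).
  by rewrite fraction_scaleE -dq mulrAC divff ?mul1r // tofrac_eq0.
by rewrite tensZr -tensZl fraction_invM.
Qed.

End FractionTensor.

(** * Maximal independent families *)

Section Independence.
Variables (R : idomainType) (S : lmodType R).
Local Notation Q := {fraction R}.
Local Notation "x %:F" := (FracField.tofrac x).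

Definition row_comb k (x : 'I_k -> S) (c : 'rV[R]_k) : S := \sum_i c 0 i *: x i.

Fact row_comb_linear k (x : 'I_k -> S) : linear (row_comb x).
Proof.
move=> a c d; rewrite /row_comb scaler_sumr -big_split; apply: eq_bigr => i _.
by rewrite !mxE scalerDl scalerA.
Qed.

HB.instance Definition _ k (x : 'I_k -> S) :=
  GRing.isLinear.Build R 'rV[R]_k S *:%R (row_comb x) (row_comb_linear x).

Definition lin_indep k (x : 'I_k -> S) := forall c, row_comb x c = 0 -> c = 0.

Lemma lin_indep_inj k (x : 'I_k -> S) : lin_indep x -> injective (row_comb x).
Proof.
by move=> xI c d E; apply/eqP; rewrite -subr_eq0; apply/eqP/xI; rewrite linearB /= E subrr.
Qed.

Hypothesis S_tf : torsion_free S.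

(** If k > n, the elements 1 (x) x_i satisfy a nontrivial relation over Q. A common denominator
    turns it into a relation over R, which descends to S. *)
Lemma lin_indep_rank n k (x : 'I_k -> S) : has_rank S n -> lin_indep x -> (k <= n)%N.
Proof.
move=> [[v2r v2r_lin [r2v v2rK r2vK]]] xI; rewrite leqNgt; apply/negP => nk.
pose L : {linear (frac_ext S : lmodType Q) -> 'rV[Q]_n} :=
  HB.pack v2r (GRing.isLinear.Build _ _ _ _ _ v2r_lin).
pose y i : frac_ext S := tens (1 : Q) (x i).
pose A := \matrix_(i < k) L (y i).
have : kermx A != 0.
  rewrite kermx_eq0 /row_free; apply: contraL nk => /eqP <-.
  by rewrite -leqNgt rank_leq_col.
case/rowV0Pn => u /sub_kermxP uA /eqP; apply.
have uy : \sum_i u 0 i *: y i = 0.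
  apply: (can_inj v2rK); rewrite -[v2r]/(L : _ -> _) linear0 linear_sum.
  apply: (etrans _ uA); rewrite mulmx_sum_row.
  by apply: eq_bigr => i _; rewrite rowK linearZ.
have /choice[d Hd] : forall i, exists d : R, d != 0 /\ exists n : R, d%:F * u 0 i = n%:F.
  by move=> i; have [d d0 dn] := fraction_denom (u 0 i); exists d.
pose D := \prod_i d i.
have D0 : D%:F != 0.
  by rewrite tofrac_eq0; apply/prodf_neq0 => i _; have [] := Hd i.
have /choice[c Hc] : forall i, exists c : R, D%:F * u 0 i = c%:F.
  move=> i; have [_ [l dl]] := Hd i; exists (\prod_(j | j != i) d j * l).
  by rewrite /D (bigD1 i) //= [d i * _]mulrC; apply: fraction_denomM.
suff c0 : \row_i c i = 0.
  apply/rowP => i; move/rowP/(_ i): c0; rewrite !mxE => ci; apply/eqP.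
  by rewrite -(inj_eq (mulfI D0)) Hc ci mulr0 rmorph0.
apply/xI/tens1_eq0 => //.
have cE i : tens (1 : Q) (c i *: x i) = D%:F *: (u 0 i *: y i) :> frac_ext S.
  rewrite scalerA Hc -tens_tofrac -[RHS]/(frac_ext_scale _ _).
  by rewrite frac_ext_scale_tens mulr1.
rewrite /row_comb (big_morph (tens (1 : Q)) (tensDr (1 : Q)) (tensr0 S (1 : Q))).
transitivity (\sum_i D%:F *: (u 0 i *: y i) : frac_ext S).
  by apply: eq_bigr => i _; rewrite mxE cE.
by rewrite -scaler_sumr uy scaler0.
Qed.

(** In a family of maximal size, adjoining s creates a relation, and its coefficient at s is nonzero
    since [x] is independent. *)
Lemma exists_maximal_indep : finite_rank S ->
  exists k (x : 'I_k -> S), lin_indep x /\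
    forall s, exists2 r, r != 0 & exists c, r *: s = row_comb x c.
Proof.
move=> [n Sn]; pose P k := asbool (exists x : 'I_k -> S, lin_indep x).
have exP : exists k, P k.
  exists 0%N; apply/asboolP; exists (fun=> 0) => c _.
  by apply/rowP; case.
have leP k : P k -> (k <= n)%N by move=> /asboolP[x xI]; apply: lin_indep_rank xI.
have [k /asboolP[x xI] kmax] := ex_maxnP exP leP.
exists k, x; split=> // s.
pose xs (i : 'I_k.+1) := if unlift ord0 i is Some j then x j else s.
have xsE c : row_comb xs c = c 0 ord0 *: s + row_comb x (\row_j c 0 (fintype.lift ord0 j)).
  rewrite /row_comb big_ord_recl /xs unlift_none; congr (_ + _).
  by apply: eq_bigr => j _; rewrite liftK mxE.
have xsD : ~ lin_indep xs.
  move=> xsI; suff /kmax : P k.+1 by rewrite ltnn.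
  by apply/asboolP; exists xs.
have [c [c0 /eqP cn0]] : exists c, row_comb xs c = 0 /\ c <> 0.
  apply: contrapT => no; apply: xsD => c c0; apply: contrapT => cn0.
  by apply: no; exists c.
exists (c 0 ord0); last first.
  exists (- \row_j c 0 (fintype.lift ord0 j)); apply/eqP.
  by rewrite linearN -subr_eq0 opprK -xsE c0.
apply: contra cn0 => /eqP c00; move: c0; rewrite xsE c00 scale0r add0r => /xI c0.
apply/eqP/rowP => i; rewrite mxE; case: (unliftP ord0 i) => [j ->|-> //].
by move/rowP/(_ j): c0; rewrite !mxE.
Qed.

End Independence.

(** * Completeness and decompositions *)

Section CompleteLocalDomain.
Variables (R : idomainType) (m : idealr R) (S : lmodType R).
Hypotheses (m_local : local_ring m) (R_noetherian : noetherian R).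
Hypotheses (R_complete : adic_complete m) (dim1 : krull_dim_eq R 1).
Hypothesis S_tf : torsion_free S.
Variable t : R.
Hypotheses (tm : t \in m) (t0 : t != 0).

Let tX0 n : t ^+ n != 0.
Proof. exact: expf_neq0. Qed.

(** * Completeness of reduced modules *)

Section Reduced.
Hypothesis S_reduced : forall s : S, (forall n, exists u, s = t ^+ n *: u) -> s = 0.
Variables (k : nat) (x : 'I_k -> S).
Hypothesis x_indep : lin_indep x.
Hypothesis x_max : forall s, exists2 r, r != 0 & exists c, r *: s = row_comb x c.

Fact expr_preim_closed n :
  submod_closed (fun c => `[< exists u, row_comb x c = t ^+ n *: u >]).
Proof.
apply: submod_closedI => [|a c d [u cu] [v dv]].
  by exists 0; rewrite linear0 scaler0.
by exists (a *: u + v); rewrite linearP /= cu dv scalerDr !scalerA mulrC.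
Qed.

Let N n : submodClosed 'rV[R]_k := mk_submod (expr_preim_closed n).

Let NP n c : c \in N n <-> exists u, row_comb x c = t ^+ n *: u.
Proof. exact: in_mk_submod. Qed.

(* Chevalley's theorem on linear topologies, for the topology that S induces on R^k. *)
Lemma chevalley : exists n, forall c, c \in N n -> exists d, c = t *: d.
Proof.
apply: contrapT => no.
have {}no n : exists2 c, c \in N n & ~ exists d, c = t *: d.
  by apply: contrapT => no'; apply: no; exists n => c cN; apply: contrapT => cd; apply: no'; exists c.
have Ndec n : {subset N n.+1 <= N n}.
  move=> c /NP[u cu]; apply/NP; exists (t *: u).
  by rewrite cu exprSr scalerA.
(* [M j] is the intersection over n of the submodules N n + t^j R^k; by the chain condition a single
   [N K] already lies in it. *)
pose M j c := forall n, exists2 u, u \in N n & exists d, c - u = t ^+ j *: d.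
have NM j : exists K, forall c, c \in N K -> M j c.
  have [K HK] := row_stationary m_local dim1 R_noetherian (k := k) (tX0 j) Ndec.
  exists K => c /HK cU n; have [u uN /multiplesP[d cd]] := cU n.
  by exists u => //; exists d.
have /choice[f Hf] : forall jc : nat * 'rV[R]_k, exists c', M jc.1 jc.2 ->
    M jc.1.+1 c' /\ exists d, c' - jc.2 = t ^+ jc.1 *: d.
  move=> [j c] /=; have [cM|] := pselect (M j c); last by exists 0.
  have [K HK] := NM j.+1; have [u uN [d cd]] := cM K.
  by exists u => _; split; [exact: HK|exists (- d); rewrite scalerN -cd opprB].
have [K HK] := NM 1%N; have [c0 c0N c0t] := no K.
(* Starting from a [c0] not divisible by t, each term is corrected to lie in the next [M]. *)
pose y : nat -> 'rV[R]_k := nat_rect (fun=> 'rV[R]_k) c0 (fun j c => f (j.+1, c)).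
have yM j : M j.+1 (y j).
  by elim: j => [|j IHj]; [exact: HK|have [] := Hf (j.+1, y j) IHj].
have yS j : exists d, y j.+1 - y j = t ^+ j.+1 *: d.
  by have [_] := Hf (j.+1, y j) (yM j).
(* The shift of index makes z agree with [y j] modulo t^(j+1), and in particular with [c0] modulo
   t. *)
have [j|z Hz] := row_adic_complete m_local dim1 R_noetherian R_complete
    (x := fun j => y j.-1) tm t0.
  case: j => [|j]; last exact: yS.
  by exists 0; rewrite scaler0 subrr.
(* Modulo t^(n+1) R^k, z is congruent to an element of [N n]. Reducedness and independence then
   force z = 0, so t divides [c0]. *)
have zN n : z \in N n.
  have [d /= zy] := Hz n.+1; have [u /NP[v uv] [e yu]] := yM n n.
  have zE : z = t ^+ n.+1 *: (d + e) + u.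
    by rewrite scalerDr -zy -yu addrA !subrK.
  apply/NP; exists (row_comb x (t *: (d + e)) + v).
  by rewrite zE linearD /= uv exprSr -scalerA linearZ /= -scalerDr.
have z0 : z = 0 by apply/x_indep/S_reduced => n; apply/NP.
have [d] := Hz 1%N; rewrite z0 sub0r expr1 => yd; apply: c0t; exists (- d).
by rewrite scalerN -yd opprK.
Qed.

(** Some power of t carries s into the span of [x]. While the exponent exceeds n, the coordinates
    are divisible by t, and cancelling t lowers it by one. *)
Lemma exists_bounded_exponent : exists n, forall s, exists c, t ^+ n *: s = row_comb x c.
Proof.
have [n Hn] := chevalley; exists n => s.
have [r r0 [c rs]] := x_max s.
have [M [a Ma]] := dvd_power m_local dim1 r0 tm.
have : exists c, t ^+ (n + M) *: s = row_comb x c.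
  exists ((t ^+ n * a) *: c).
  by rewrite linearZ /= -rs scalerA exprD Ma mulrA.
elim: M {Ma} => [|M IHM]; first by rewrite addn0.
move=> [d sd]; apply: IHM.
have /Hn[e de] : d \in N n.
  by apply/NP; exists (t ^+ M.+1 *: s); rewrite -sd scalerA exprD.
exists e; apply: (scaler_inj S_tf t0).
by rewrite scalerA -exprS -addnS sd de linearZ.
Qed.

(** Multiplication by t^n moves the sequence into a free module, where it converges. The limit is
    divisible by t^n in S, and the quotient is the limit sought. *)
Lemma reduced_complete (s : nat -> S) :
  (forall n, exists u, s n.+1 - s n = t ^+ n *: u) ->
  exists y, forall n, exists u, y - s n = t ^+ n *: u.
Proof.
move=> sC; have [n Hn] := exists_bounded_exponent.
have /choice[c Hc] := fun j => Hn (s j).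
have [j|z Hz] := row_adic_complete m_local dim1 R_noetherian R_complete (x := c) tm t0.
  have [u su] := sC j; have [b ub] := Hn u; exists b.
  apply: (lin_indep_inj x_indep); rewrite linearB linearZ /= -!Hc -ub -scalerBr su.
  by rewrite !scalerA mulrC.
have [b zb] := Hz n.
have zE : row_comb x z = t ^+ n *: (s n + row_comb x b).
  by rewrite scalerDr Hc -linearZ -linearD -zb addrC subrK.
exists (s n + row_comb x b) => j.
(* The precision t^(j+n) leaves t^j after division by t^n. *)
have [d zd] := Hz (j + n)%N; have [u su] := scale_telescope sC j n.
exists (row_comb x d + u); rewrite -(subrKA (s (j + n)%N)) su scalerDr; congr (_ + _).
apply: (scaler_inj S_tf (tX0 n)).
by rewrite scalerBr -zE Hc -linearB zd linearZ /= exprD scalerA mulrC.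
Qed.

End Reduced.

(** * Splitting off the divisible part *)

Lemma scaler_expr_comp n k (s : S) : t ^+ (n + k) *: s = t ^+ n *: (t ^+ k *: s).
Proof. by rewrite exprD scalerA. Qed.

(** A submodule [C] maximal with zero intersection with the divisible part [W] is a complement of
    [W]; as W is nonzero, indecomposability gives C = 0. *)
Lemma nonreduced_divisible : indecomposable S ->
  (exists2 w : S, w != 0 & forall n, exists u, w = t ^+ n *: u) ->
  forall (s : S) n, exists u, s = t ^+ n *: u.
Proof.
move=> [_ Sind] [w w0 wdiv].
have [||W WE] := @submod_of R S (fun s => forall n, exists u, s = t ^+ n *: u).
- by move=> n; exists 0; rewrite scaler0.
- move=> a u v udiv vdiv n; have [u' ->] := udiv n; have [v' ->] := vdiv n.
  by exists (a *: u' + v'); rewrite scalerDr !scalerA mulrC.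
have Wdiv r v : r != 0 -> v \in W -> exists2 v', v' \in W & v = r *: v'.
  move=> r0 vW; have [n [a ta]] := dvd_power m_local dim1 r0 tm.
  have /WE/(_ n)[u vu] := vW; exists (a *: u); last by rewrite vu ta scalerA mulrC.
  apply: rpredZ; apply/WE => k; have /WE/(_ (n + k)%N)[u' vu'] := vW; exists u'.
  by apply: (scaler_inj S_tf (tX0 n)); rewrite -vu vu' scaler_expr_comp.
have [||O OE] := @submod_of R S (fun s => s = 0); [by []| |].
  by move=> a u v -> ->; rewrite scaler0 addr0.
have [v /OE -> [_]|C [_ CX Cmax]] :=
  @exists_maximal_avoiding _ _ O (fun s => s \in W /\ s != 0); first by rewrite eqxx.
have CW0 v : v \in C -> v \in W -> v = 0.
  by move=> vC vW; apply/eqP; apply: contraT => v0; case: (CX v).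
(* If s were outside [C], then C + Rs would contain a nonzero v in [W], yet r v lies in both [C] and
   [W]. *)
have Csat r s : r != 0 -> r *: s \in C -> s \in C.
  move=> r0 rsC; apply: contraT => /Cmax[v /add_lineP[a vaC] [vW /eqP]]; case.
  apply: (scaler_inj S_tf r0); rewrite scaler0; apply: CW0; last exact: rpredZ.
  rewrite -(subrK (a *: s) v) scalerDr; apply: rpredD; first exact: rpredZ.
  by rewrite scalerA mulrC -scalerA rpredZ.
have WC s : exists a b, [/\ a \in W, b \in C & s = a + b].
  have [sC|/Cmax[v /add_lineP[r vrC] [vW v0]]] := boolP (s \in C).
    by exists 0, s; rewrite rpred0 add0r.
  have r0 : r != 0.
    by apply: contraNneq v0 => r0; rewrite r0 scale0r subr0 in vrC; apply/eqP/CW0.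
  (* Since v is congruent to r s modulo [C], its quotient by r in [W] is the component of s. *)
  have [v' v'W vE] := Wdiv r v r0 vW.
  exists v', (s - v'); rewrite v'W [v' + _]addrC subrK; split=> //.
  by apply: (Csat r) => //; rewrite scalerBr -vE -opprB -scaleN1r rpredZ.
have [//|s sW sC|W0|C0] := Sind W C; first exact: CW0.
  by case/eqP: w0; apply/W0/WE.
by move=> s; apply/WE; have [a [b [aW /C0 -> ->]]] := WC s; rewrite addr0.
Qed.

Lemma divisible_tensor0 : (forall (s : S) n, exists u, s = t ^+ n *: u) ->
  forall d : tensor (frac_quot R) S, d = 0.
Proof.
move=> Sdiv d; have [e e0 [s ->]] := frac_quot_tensorP d.
have [n [a ta]] := dvd_power m_local dim1 e0 tm.
have [u ->] := Sdiv s n; rewrite ta mulrC -scalerA tensZr -tensZl.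
by rewrite scaler_fraction_inv // -(scale0r 0) tensZl scale0r.
Qed.

(** * Transfer of decompositions from D to S *)

Local Notation D := (tensor (frac_quot R) S).

(** This map induces an isomorphism of S/t^n S onto the elements of D killed by t^n. *)
Let theta n (s : S) : D := tens (fraction_inv (t ^+ n)) s.

Let theta_inj n s : theta n s = 0 -> exists u, s = t ^+ n *: u.
Proof. exact: (tens_fraction_inv_eq0 S_tf (tX0 n)). Qed.

Let thetaZ a n s : theta n (a *: s) = a *: theta n s.
Proof. exact: tensZr. Qed.

Let thetaB n s u : theta n (s - u) = theta n s - theta n u.
Proof. by rewrite /theta tensDr tensNr. Qed.

Let theta_shift n k s : theta (n + k) (t ^+ k *: s) = theta n s.
Proof. by rewrite /theta tensZr -tensZl exprD mulrC fraction_invM. Qed.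

Let theta_kill n s : theta n (t ^+ n *: s) = 0.
Proof. by rewrite /theta tensZr -tensZl scaler_fraction_inv // -(scale0r 0) tensZl scale0r. Qed.

Let theta_surj d : exists n s, d = theta n s.
Proof.
have [e e0 [s ->]] := frac_quot_tensorP d.
have [n [a ta]] := dvd_power m_local dim1 e0 tm; exists n, (a *: s).
rewrite /theta ta tensZr -tensZl fraction_invM //.
by apply: contraNneq (tX0 n) => a0; rewrite ta a0 mul0r.
Qed.

Let theta_annihilated n d : t ^+ n *: d = 0 -> exists s, d = theta n s.
Proof.
have [k [s ->]] := theta_surj d; rewrite -thetaZ => /theta_inj[u su].
exists u; apply: etrans (theta_shift n k u).
by rewrite -su addnC theta_shift.
Qed.

Lemma tensor_indecomposable : indecomposable S -> finite_rank S ->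
  (exists d : D, d != 0) -> indecomposable D.
Proof.
move=> Sind Srank [d0 d0n]; split; first by exists d0.
have S_reduced (s : S) : (forall n, exists u, s = t ^+ n *: u) -> s = 0.
  move=> sdiv; apply/eqP; apply: contraT => s0; case/eqP: d0n.
  by apply: divisible_tensor0; apply: nonreduced_divisible => //; exists s.
have [k [x [x_indep x_max]]] := exists_maximal_indep S_tf Srank.
move=> A B AB AB0.
have inter_submod (C : submodClosed D) : exists SC : submodClosed S,
    forall s, s \in SC <-> forall n, theta n s \in C.
  apply: submod_of => [n|a u v uC vC n]; first by rewrite /theta tensr0 rpred0.
  rewrite /theta tensDr tensZr.
  by apply: rpredD; [apply/rpredZ/uC|apply: vC].
have [SA SAP] := inter_submod A; have [SB SBP] := inter_submod B.
have SAB0 s : s \in SA -> s \in SB -> s = 0.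
  by move=> /SAP sA /SBP sB; apply: S_reduced => n; apply/theta_inj/AB0; [apply: sA|apply: sB].
have SAB s : exists a b, [/\ a \in SA, b \in SB & s = a + b].
  (* The A-component of [theta n s] is killed by t^n because its sum with the B-component is, so it
     is again a value of [theta n]. *)
  have /choice[u Hu] : forall n, exists u, theta n u \in A /\ theta n (s - u) \in B.
    move=> n; have [a [b [aA bB sE]]] := AB (theta n s).
    have [|u au] := @theta_annihilated n a.
      apply: AB0; first exact: rpredZ.
      suff -> : t ^+ n *: a = - (t ^+ n *: b) by rewrite -scaleN1r !rpredZ.
      by apply/eqP; rewrite -subr_eq0 opprK -scalerDr -sE -thetaZ theta_kill.
    by exists u; rewrite thetaB sE -au addrC addKr.
  have uS n k' : theta n (u (n + k')%N) \in A /\ theta n (s - u (n + k')%N) \in B.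
    have [uA uB] := Hu (n + k')%N.
    by rewrite -(theta_shift n k') -(theta_shift n k' (s - _)) !thetaZ !rpredZ.
  have [n|y Hy] := reduced_complete S_reduced x_indep x_max (s := u).
    apply: theta_inj; have [u1A u1B] := uS n 1%N; have [uA uB] := Hu n.
    rewrite addn1 in u1A u1B; apply: AB0; first by rewrite thetaB submod_rpredB.
    (* At level n, both u (n+1) and u n give A-components of the same element, so their difference
       lies in A and in B. *)
    suff -> : u n.+1 - u n = (s - u n) - (s - u n.+1) by rewrite thetaB submod_rpredB.
    by rewrite opprB [RHS]addrC subrKA.
  have yE n : theta n y = theta n (u n).
    apply/eqP; rewrite -subr_eq0 -thetaB; have [v ->] := Hy n.
    by rewrite theta_kill.
  exists y, (s - y); split; last by rewrite addrC subrK.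
    by apply/SAP => n; rewrite yE; have [] := Hu n.
  by apply/SBP => n; rewrite thetaB yE -thetaB; have [] := Hu n.
have [|SA0|SB0] := (proj2 Sind) SA SB SAB; first exact: SAB0.
  (* If [SA] vanishes, every s lies in [SB], so B is all of D and A is zero. *)
  left=> d dA; have [n [s dE]] := theta_surj d.
  have [a [b [/SA0 a0 /SBP bB sE]]] := SAB s.
  by apply: AB0 => //; rewrite dE sE a0 add0r; apply: bB.
right=> d dB; have [n [s dE]] := theta_surj d.
have [a [b [/SAP aA /SB0 b0 sE]]] := SAB s.
by apply: AB0 => //; rewrite dE sE b0 addr0; apply: aA.
Qed.

End CompleteLocalDomain.

Theorem theorem9p2 (R : idomainType) (m : idealr R) (S : lmodType R) :
  local_ring m -> noetherian R -> adic_complete m -> krull_dim_eq R 1 ->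
  torsion_free S -> finite_rank S -> indecomposable S ->
  (exists t : tensor (frac_quot R) S, t != 0) ->
  indecomposable (tensor (frac_quot R) S).
Proof.
move=> m_local R_noeth R_compl dim1 S_tf Srank Sind.
have [t tm t0] := exists_nonzero_nonunit m_local dim1.
exact: (tensor_indecomposable m_local R_noeth R_compl dim1 S_tf tm t0).
Qed.
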